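(* Let $p\ge 5$ be a prime and let $k\ge 2$ be a positive integer such that $p-1\nmid 2k-2$. Then $$2S_{2k+1}(p)\equiv (2k+1)pS_{2k}(p)\pmod{p^4}.$$ Furthermore, if in addition $p-1\nmid 2k$, then $$S_{2k+1}(p)\equiv 0\pmod{p^2}.$$
   Context: For integers $k\ge 1$ and $n\ge 2$, $S_k(n):=\sum_{i=1}^{n-1} i^k=1^k+2^k+\cdots+(n-1)^k$. *)

(* Defs.v *)
From mathcomp Require Import all_boot.
Set Implicit Arguments.
Unset Strict Implicit.
Unset Printing Implicit Defensive.

(* S_k(n) = 1^k + 2^k + ... + (n-1)^k; the upper bound n is excluded. *)
Definition power_sum (k n : nat) : nat := \sum_(1 <= i < n) i ^ k.

(* Main.v *)
Require Import Defs.
From mathcomp Require Import all_boot.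
From mathcomp Require Import all_order all_algebra finfield.
From mathcomp Require Import ring zify.

(** The involution i |-> p - i of {1, ..., p-1} drives the proof. Expanding
    (p - i)^m binomially and summing over i gives, for every N,
      S_m(p) = \sum_(j < N) (-1)^(m-j) C(m,j) p^j S_(m-j)(p)  modulo p^N
    (lemma [power_sum_reflection]). When m is odd the term j = 0 is -S_m(p),
    so it moves to the left and produces 2 S_m(p).

    For m = 2k+1 and N = 4 this reads
      2 S_(2k+1) = (2k+1) p S_(2k) - C(2k+1,2) p^2 S_(2k-1)
                   + C(2k+1,3) p^3 S_(2k-2)  modulo p^4.
    The last term vanishes because p divides S_e(p) whenever p - 1 does not
    divide e (lemma [prime_dvd_power_sum]), here with e = 2k-2. The term in
    p^2 vanishes because p^2 divides S_(2k-1): this is the same expansion for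
    m = 2k-1 and N = 2, where 2 S_(2k-1) = (2k-1) p S_(2k-2) modulo p^2
    (lemma [sqr_prime_dvd_odd_power_sum]). That lemma applied to m = 2k+1 is
    also the second assertion. *)

Import GRing.Theory.

Section PowerSums.

Local Open Scope ring_scope.

(** Otherwise, with r the residue of e modulo p - 1, the p - 1 nonzero elements
    would all be roots of X^r - 1, although 0 < r < p - 1. *)
Lemma Fp_exists_expf_neq1 {p e : nat} : prime p -> ~~ (p - 1 %| e)%N ->
  exists2 a : 'F_p, a != 0 & a ^+ e != 1.
Proof.
move=> p_pr ndvd; apply/exists_inP; apply: contraNT ndvd => /exists_inPn all1.
have p_gt1 := prime_gt1 p_pr.
have fermat (a : 'F_p) : a != 0 -> a ^+ (p - 1) = 1.
  move=> a0; apply: (mulfI a0).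
  by rewrite -exprS subn1 prednK ?prime_gt0 // mulr1 -{2}(expf_card a) card_Fp.
rewrite /dvdn -leqn0 leqNgt; apply/negP => r_gt0.
pose r := (e %% (p - 1))%N.
have roots : all r.-unity_root (enum (predC1 (0 : 'F_p))).
  apply/allP => a; rewrite mem_enum => a0; apply/unity_rootP.
  rewrite -(eqP (negbNE (all1 a a0))) [in RHS](divn_eq e (p - 1)).
  by rewrite exprD mulnC exprM fermat // expr1n mul1r.
have := max_unity_roots r_gt0 roots (enum_uniq _).
rewrite -cardE cardC1 card_Fp // -subn1 leqNgt ltn_mod.
by rewrite subn_gt0 p_gt1.
Qed.

(** Multiplication by a nonzero a permutes 'F_p, so the sum of the x^e is
    unchanged when multiplied by a^e, and is 0 if some a^e differs from 1. *)
Lemma prime_dvd_power_sum {p e : nat} : prime p -> ~~ (p - 1 %| e)%N ->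
  (p %| power_sum e p)%N.
Proof.
move=> p_pr ndvd.
have e_gt0 : (0 < e)%N by case: e ndvd => //; rewrite dvdn0.
have [a a0 ae1] := Fp_exists_expf_neq1 p_pr ndvd.
have sum0 : \sum_(x : 'F_p) x ^+ e = 0.
  apply/eqP; have: (a ^+ e - 1) * \sum_(x : 'F_p) x ^+ e == 0.
    rewrite mulrBl mul1r subr_eq0 mulr_sumr.
    rewrite [eqbRHS](reindex_inj (mulfI a0)) /=.
    by apply/eqP/eq_bigr => x _; rewrite exprMn.
  by rewrite mulf_eq0 subr_eq0 (negPf ae1).
rewrite (dvdn_pcharf (pchar_Fp p_pr)) -sum0 /power_sum natr_sum; apply/eqP.
under eq_bigr do rewrite natrX.
(* The index 0 can be added since e > 0; the sum then runs over the ordinals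
   that are the elements of 'F_p. *)
transitivity (\sum_(0 <= i < p) (i%:R : 'F_p) ^+ e).
  by rewrite [RHS]big_ltn ?prime_gt0 // expr0n gtn_eqF // add0r.
rewrite (_ : index_iota 0 p = index_iota 0 (Zp_trunc (pdiv p)).+2); last first.
  by rewrite Fp_cast.
rewrite big_mkord.
by apply: eq_bigr => x _; rewrite natr_Zp.
Qed.

(** Terms of the binomial expansion with index at least N carry a factor y^N;
    for m < N the additional terms on the right have zero coefficients. The
    cofactor c is given by a sigma type so that the cofactors of a family of
    expansions can be summed without a choice principle. *)
Lemma exprD_trunc {R : comNzRingType} (x y : R) (m N : nat) :
  {c | (x + y) ^+ m
       = \sum_(j < N) x ^+ (m - j) * y ^+ j *+ 'C(m, j) + y ^+ N * c}.
Proof.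
pose t j := x ^+ (m - j) * y ^+ j *+ 'C(m, j).
exists (\sum_(N <= j < m.+1) x ^+ (m - j) * y ^+ (j - N) *+ 'C(m, j)).
have -> : y ^+ N * (\sum_(N <= j < m.+1)
    x ^+ (m - j) * y ^+ (j - N) *+ 'C(m, j)) = \sum_(N <= j < m.+1) t j.
  rewrite mulr_sumr; apply: eq_big_nat => j /andP[Nj _].
  by rewrite /t -[in y ^+ j](subnKC Nj) exprD mulrnAr; congr (_ *+ _); ring.
rewrite exprDn -(big_mkord xpredT t) -(big_mkord xpredT t).
have [le_Nm|lt_mN] := leqP N m.+1; first by rewrite -big_cat_nat.
rewrite [X in _ + X]big_geq ?(ltnW lt_mN) // addr0.
rewrite [RHS](big_cat_nat (leq0n _) (ltnW lt_mN)) /= [X in _ + X]big_nat.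
rewrite [X in _ + X]big1 ?addr0 // => j /andP[lt_mj _].
by rewrite /t bin_small.
Qed.

(** Replacing i by n - i permutes the summation range; each (n - i)^m is then
    expanded with truncation in powers of n, and the sums are exchanged. *)
Lemma power_sum_reflection (n m N : nat) : exists c : int,
  (power_sum m n)%:Z =
    \sum_(j < N) (-1) ^+ (m - j) * 'C(m, j)%:Z * n%:Z ^+ j
                 * (power_sum (m - j) n)%:Z
    + n%:Z ^+ N * c.
Proof.
have powE e : (power_sum e n)%:Z = \sum_(1 <= i < n) i%:Z ^+ e.
  rewrite /power_sum -[LHS]natz natr_sum.
  by apply: eq_bigr => i _; rewrite natrX natz.
exists (\sum_(1 <= i < n) sval (exprD_trunc (- i%:Z) n%:Z m N)).
under [in RHS]eq_bigr do rewrite powE mulr_sumr.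
rewrite exchange_big mulr_sumr -big_split /= powE big_nat_rev /=.
apply: eq_big_nat => i /andP[_ lt_in].
rewrite (_ : (1 + n - i.+1)%:Z = - i%:Z + n%:Z); last by lia.
case: (exprD_trunc (- i%:Z) n%:Z m N) => /= c ->; congr (_ + _).
apply: eq_bigr => j _.
by rewrite [in LHS]exprNn -mulr_natr natz; ring.
Qed.

(** Reflection with N = 2 and odd exponent gives 2 S_(e+1) = (e+1) p S_e modulo
    p^2, where S_e is itself divisible by p; the factor 2 is prime to p. *)
Lemma sqr_prime_dvd_odd_power_sum {p e : nat} : prime p -> (2 < p)%N ->
  ~~ odd e -> ~~ (p - 1 %| e)%N -> (p ^ 2 %| power_sum e.+1 p)%N.
Proof.
move=> p_pr p_gt2 e_even /(prime_dvd_power_sum p_pr)/dvdnP[q Sq].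
rewrite -(@Gauss_dvdr _ 2); last first.
  by rewrite coprimeXl // coprimen2; apply: contraTT p_gt2;
     case: (even_prime p_pr) => -> .
have [c] := power_sum_reflection p e.+1 2.
rewrite !big_ord_recl big_ord0 /= /bump /= subn0 subn1 /= bin0 bin1 Sq.
rewrite exprS -signr_odd (negPf e_even) PoszM.
move: (power_sum _ _) => S refl.
suff: (p%:Z ^+ 2 %| 2 * S%:Z)%Z by rewrite dvdzE abszX abszM.
apply/dvdzP; exists (e.+1%:Z * q%:Z + c).
by rewrite mulr_natl mulr2n {1}refl; ring.
Qed.

End PowerSums.

Theorem proposition2p5 (p k : nat) (p_prime : prime p) (p_ge5 : 5 <= p)
    (k_ge2 : 2 <= k) (p1_ndvd : ~~ (p - 1 %| 2 * k - 2)) :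
  2 * power_sum (2 * k + 1) p
    = (2 * k + 1) * p * power_sum (2 * k) p %[mod p ^ 4]
  /\ (~~ (p - 1 %| 2 * k) -> power_sum (2 * k + 1) p = 0 %[mod p ^ 2]).
Proof.
have p_gt2 : 2 < p by apply: leq_trans p_ge5.
split=> [|ndvd]; last first.
  rewrite addn1 mod0n; apply/eqP.
  by apply: sqr_prime_dvd_odd_power_sum; rewrite // mul2n odd_double.
have even_e : ~~ odd (2 * k - 2) by lia.
have /dvdnP[a Sa] := prime_dvd_power_sum p_prime p1_ndvd.
have /dvdnP[b Sb] := sqr_prime_dvd_odd_power_sum p_prime p_gt2 even_e p1_ndvd.
have [c] := power_sum_reflection p (2 * k + 1) 4.
rewrite !big_ord_recl big_ord0 /= /bump /= bin0 bin1 subn0.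
rewrite (_ : 2 * k + 1 - 1 = 2 * k); last by lia.
rewrite (_ : 2 * k + 1 - 2 = (2 * k - 2).+1); last by lia.
rewrite (_ : 2 * k + 1 - 3 = 2 * k - 2); last by lia.
(* Only the parity of m - j matters for the sign of the term of index j. *)
rewrite -(signr_odd _ (2 * k + 1)) -(signr_odd _ (2 * k)).
rewrite -(signr_odd _ (2 * k - 2).+1) -(signr_odd _ (2 * k - 2)).
rewrite oddS (negPf even_e) addn1 oddS oddM /= Sa Sb.
move: (power_sum _ p) (power_sum _ p) => S T refl.
apply/eqP; rewrite -eqz_nat -!modz_nat eqz_mod_dvd; apply/dvdzP.
move: refl; set B := 'C(_, _); set D := 'C(_, _); rewrite !PoszM => refl.
exists (c - B%:Z * b%:Z + D%:Z * a%:Z)%R.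
rewrite (_ : 2%:Z * T%:Z = T%:Z + T%:Z)%R; last by ring.
by rewrite {1}refl; ring.
Qed.
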